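(* Let $L\subseteq\mathbb{R}^n$ be a linear subspace and fix $\delta>0$. Then there exists $R>0$ such that, for every $x\in L$, there is an integer point $y\in\mathbb{Z}^n$ satisfying $\|y-x\|\le R$ and $\operatorname{dist}(y,L)\le\delta$.
   Context: $\|\cdot\|$ is the Euclidean norm and $\operatorname{dist}(y,L)=\inf\{\|y-b\|:b\in L\}$. The subspace $L$ is not assumed to be rational. *)

(* Defs.v *)
From HB Require Import structures.
From mathcomp Require Import all_boot all_order all_algebra.
From mathcomp Require Import classical_sets reals.

Set Implicit Arguments.
Unset Strict Implicit.
Unset Printing Implicit Defensive.

Import Order.TTheory GRing.Theory Num.Theory.
Local Open Scope classical_set_scope.
Local Open Scope ring_scope.

(* Not the library norm [`|v|] on matrices, which is the sup norm. *)
Definition enorm (R : realType) (n : nat) (v : 'rV[R]_n) : R :=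
  Num.sqrt (\sum_(i < n) v 0 i ^+ 2).

(* [inf] returns 0 on a set that is empty or not bounded below; neither case
   arises here, since [0 \in L] and [enorm] is nonnegative. *)
Definition dist (R : realType) (n : nat) (y : 'rV[R]_n)
    (L : {vspace 'rV[R]_n}) : R :=
  inf [set enorm (y - b) | b in [set b | b \in L]].

Definition ipoint (R : realType) (n : nat) (z : 'rV[int]_n) : 'rV[R]_n :=
  map_mx intr z.

(* Main.v *)
Require Import Defs.
From HB Require Import structures.
From mathcomp Require Import all_boot all_order all_algebra.
From mathcomp Require Import boolp classical_sets reals.
From mathcomp Require Import lra.

Set Implicit Arguments.
Unset Strict Implicit.
Unset Printing Implicit Defensive.

Import Order.TTheory GRing.Theory Num.Theory.
Local Open Scope ring_scope.

(** The idea is that the image of [L] in the torus R^n / Z^n is totally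
    bounded.  Cut the torus into finitely many cubes of side [1 / K]; in each
    cube met by [L] fix one point [a] of [L].  If [x] in [L] falls in the same
    cube as [a], then the integer point z = floor x - floor a differs from
    x - a, which lies in [L], by at most [1 / K] in each coordinate, so [z] is
    as close to [L] as desired once [K] is large; and z - x is within the same
    error of [- a], one of finitely many vectors, which bounds it uniformly.
    Comparing [x] with a single representative, rather than writing it as an
    integer combination of near-integral vectors of [L], keeps the errors from
    accumulating as [x] goes to infinity.  [cell_close] is the estimate in one
    coordinate, and [enorm_le_sum] turns coordinatewise estimates into
    estimates of the Euclidean norm. *)

(** The square of the right-hand side is the sum of squares plus nonnegative
    cross terms.  Sums of absolute values then serve in place of the triangle
    inequality for [enorm]. *)
Lemma enorm_le_sum (R : realType) (n : nat) (v : 'rV[R]_n) :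
  enorm v <= \sum_(i < n) `|v 0 i|.
Proof.
have s0 (P : pred 'I_n) : 0 <= \sum_(i < n | P i) `|v 0 i| by apply: sumr_ge0.
rewrite -[leRHS]ger0_norm ?s0// -sqrtr_sqr ler_wsqrtr// expr2 mulr_suml.
apply: ler_sum => i _; rewrite -real_normK ?num_real// expr2 ler_wpM2l//.
by rewrite (bigD1 i)//= lerDl s0.
Qed.

Lemma dist_le_enorm (R : realType) (n : nat) (L : {vspace 'rV[R]_n})
    (y b : 'rV[R]_n) : b \in L -> dist y L <= enorm (y - b).
Proof.
move=> bL; apply: ge_inf; last by exists b.
by exists 0 => _ [c _ <-]; exact: sqrtr_ge0.
Qed.

(** Cuts the circle R / Z into [k.+1] arcs of equal length; a fractional part
    is less than 1, so the argument of [inord] is always in range. *)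
Definition cell (R : realType) (k : nat) (x : R) : 'I_k.+1 :=
  inord (Num.truncn (k.+1%:R * (x - (Num.floor x)%:~R))).

(** Two fractional parts in the same arc differ by at most its length, and
    subtracting the floors turns that difference into a distance from x - a to
    an integer. *)
Lemma cell_close (R : realType) (k : nat) (x a : R) :
  cell k x = cell k a ->
  `|(Num.floor x - Num.floor a)%:~R - (x - a)| <= k.+1%:R^-1.
Proof.
have K0 : 0 < k.+1%:R :> R by [].
have frac (u : R) : 0 <= u - (Num.floor u)%:~R < 1.
  have /andP[] := floor_itv u; rewrite intrD => ? ?; lra.
have truncE (u : R) :
    let f := k.+1%:R * (u - (Num.floor u)%:~R) in
    (cell k u)%:R <= f < (cell k u).+1%:R.
  have /andP[f0 f1] := frac u.
  have g0 : 0 <= k.+1%:R * (u - (Num.floor u)%:~R) by rewrite mulr_ge0// ltW.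
  rewrite /= /cell inordK; first exact: truncn_itv.
  by rewrite truncn_lt_nat// -[ltRHS]mulr1 ltr_pM2l.
move=> eq_c; have /= := truncE x; rewrite eq_c => /andP[x1 x2].
have /= /andP[a1 a2] := truncE a.
rewrite -(ler_pM2l K0) mulfV ?gt_eqF// -[X in X * _]gtr0_norm// -normrM.
rewrite ler_norml intrB; move: x2 a2; rewrite -natr1 => x2 a2.
apply/andP; split; lra.
Qed.

Theorem lemma7 (R : realType) (n : nat) (L : {vspace 'rV[R]_n})
    (delta : R) (hdelta : 0 < delta) :
  exists r : R, 0 < r /\
    forall x : 'rV[R]_n, x \in L ->
      exists z : 'rV[int]_n,
        enorm (ipoint R z - x) <= r /\ dist (ipoint R z) L <= delta.
Proof.
(* [k.+1] exceeds n / delta, so that [n] coordinate errors of at most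
   [1 / k.+1] add up to at most [delta]. *)
pose k := Num.truncn (n%:R / delta).
have small : \sum_(i < n) k.+1%:R^-1 <= delta.
  rewrite sumr_const card_ord -[leLHS]mulr_natl ler_pdivrMr// mulrC.
  by rewrite -ler_pdivrMr// ltW// truncnS_gt.
pose cube (x : 'rV[R]_n) := [ffun i => cell k (x 0 i)].
have [rep repP] : exists rep : {ffun 'I_n -> 'I_k.+1} -> 'rV[R]_n,
    forall c x, x \in L -> cube x = c -> rep c \in L /\ cube (rep c) = c.
  apply: (@fin_all_exists _ (fun=> 'rV[R]_n) (fun c a => forall x,
    x \in L -> cube x = c -> a \in L /\ cube a = c)) => c.
  have [[a [aL ac]]|no] := pselect (exists a, a \in L /\ cube a = c).
    by exists a.
  (* a cube that misses [L] gets an arbitrary representative *)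
  by exists 0 => x xL xc; case: no; exists x.
pose size1 c := \sum_(i < n) `|rep c 0 i|.
have size1_ge0 c : 0 <= size1 c by apply: sumr_ge0.
exists (\sum_c size1 c + delta); split.
  by rewrite ltr_wpDl// sumr_ge0.
move=> x xL; have [] := repP (cube x) x xL erefl.
set a := rep (cube x) => aL ac.
pose z := \row_i (Num.floor (x 0 i) - Num.floor (a 0 i)).
have close i : `|(ipoint R z - (x - a)) 0 i| <= k.+1%:R^-1.
  rewrite !mxE; apply: cell_close.
  by move/ffunP: ac => /(_ i); rewrite !ffunE.
have close1 : \sum_(i < n) `|(ipoint R z - (x - a)) 0 i| <= delta.
  by apply: le_trans small; apply: ler_sum => i _; exact: close.
exists z; split; last first.
  apply: le_trans (dist_le_enorm _ (rpredB xL aL)) _.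
  exact: le_trans (enorm_le_sum _) close1.
apply: le_trans (enorm_le_sum _) _.
(* z - x is - a plus the error z - (x - a) *)
apply: (@le_trans _ _ (size1 (cube x) +
    \sum_(i < n) `|(ipoint R z - (x - a)) 0 i|)).
  rewrite -big_split/=; apply: ler_sum => i _; rewrite -/a.
  have -> : (ipoint R z - x) 0 i = - a 0 i + (ipoint R z - (x - a)) 0 i.
    rewrite !mxE; lra.
  by rewrite -[in leRHS](normrN (a 0 i)) ler_normD.
by rewrite lerD// (bigD1 (cube x))//= lerDl sumr_ge0.
Qed.
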